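(* For every integer $k \geq 2$ and every integer $t \geq 0$: $\iota(k) \leq \frac{1}{2}$ if and only if $\iota(k,t) \leq \frac{1}{2}$.
   Context: All graphs are finite and simple. $d_G(v)$ is the degree of $v$ in $G$, $\Delta(G)$ and $\delta(G)$ are the maximum and minimum degree, and $V_i(G)=\{v\in V(G) : d_G(v)=i\}$. $\chi'(G)$ is the chromatic index (least number of colors in a proper edge-coloring). For $k \geq 2$, a connected graph $G$ is $k$-critical if $\Delta(G)=k$, $\chi'(G)=k+1$ and $\chi'(G-e)=k$ for every $e \in E(G)$; $\mathcal{C}(k)$ denotes the set of $k$-critical graphs. $\alpha(G)$ is the maximum cardinality of an independent set of vertices of $G$, and $\iota(G)=\alpha(G)/|V(G)|$. For integers $k \geq 2$ and $t \geq 0$, $\mathcal{C}(k,t)$ is the set of $k$-critical graphs $G$ such that: (1) $\delta(G)\geq k-1$; (2) to each $v \in V_{k-1}(G)$ one can assign $k-1$ (distinguished) paths $p^t_1(v),\dots,p^t_{k-1}(v)$ in $G$ with initial vertex $v$, such that for all $v\in V_{k-1}(G)$ and all $i,j\in\{1,\dots,k-1\}$: (a) $V(p^t_i(v))\cap V_{k-1}(G)=\{v\}$; (b) $|V(p^t_i(v))|\geq 2t(k-1)+2$; (c) if $i\neq j$, then $V(p^t_i(v))\cap V(p^t_j(v))=\{v\}$; (d) if $w\in V_{k-1}(G)$ and $w\neq v$, then $V(p^t_i(v))\cap V(p^t_j(w))=\emptyset$. $\iota(k)=\sup\{\iota(G) : G\in\mathcal{C}(k)\}$ and $\iota(k,t)=\sup\{\iota(G)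 : G\in\mathcal{C}(k,t)\}$. *)

(* Defs.v *)
From HB Require Import structures.
From mathcomp Require Import all_boot all_order all_algebra.
From mathcomp Require Import classical_sets reals.

Set Implicit Arguments.
Unset Strict Implicit.
Unset Printing Implicit Defensive.

Import Order.TTheory GRing.Theory Num.Theory.

Record sgraph := SGraph {
  vertex :> finType;
  adj : rel vertex;
  adj_sym : symmetric adj;
  adj_irr : irreflexive adj }.

Arguments adj {s} x y.

Section Basics.
Variable G : sgraph.

Definition edges : {set {set G}} :=
  [set [set u.1; u.2] | u : G * G & adj u.1 u.2].

Definition deg (v : G) : nat := #|[set w | adj v w]|.

Definition max_deg : nat := \max_(v : G) deg v.

(* Every degree is less than #|G|, so the default value #|G| only matters for
   the graph without vertices. *)
Definition min_deg : nat := \big[minn/#|G|]_(v : G) deg v.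

Definition deg_class (i : nat) : {set G} := [set v | deg v == i].

Definition graph_connected : bool := [forall x : G, forall y : G, connect adj x y].

Definition independent (S : {set G}) : bool :=
  [forall x in S, forall y in S, ~~ adj x y].

Definition indep_num : nat := \max_(S : {set G} | independent S) #|S|.

(* Colors are assigned to the edges only, so that 0 colors suffice exactly
   when there is no edge. *)
Definition edge_type : finType := {e : {set G} | e \in edges}.

Definition proper_edge_coloring n (c : {ffun edge_type -> 'I_n}) : bool :=
  [forall e, forall f,
    (e != f) && (val e :&: val f != finset.set0) ==> (c e != c f)].

Definition edge_colorable (n : nat) : bool :=
  [exists c : {ffun edge_type -> 'I_n}, proper_edge_coloring c].

Lemma edge_colorable_ex : exists n, edge_colorable n.
Proof.
exists #|edge_type|; apply/existsP; exists [ffun e => enum_rank e].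
apply/forallP => e; apply/forallP => f; apply/implyP => /andP[ef _].
by rewrite !ffunE; apply: contra_neq ef => /enum_rank_inj.
Qed.

Definition chromatic_index : nat := ex_minn edge_colorable_ex.

Definition del_adj (e : {set G}) : rel G :=
  fun x y => adj x y && ([set x; y] != e).

Lemma del_adj_sym e : symmetric (del_adj e).
Proof. by move=> x y; rewrite /del_adj adj_sym finset.setUC. Qed.

Lemma del_adj_irr e : irreflexive (del_adj e).
Proof. by move=> x; rewrite /del_adj adj_irr. Qed.

Definition del_edge (e : {set G}) : sgraph :=
  SGraph (del_adj_sym e) (del_adj_irr e).

(* [v :: p] is the vertex sequence of a path of G with initial vertex v. *)
Definition graph_path (v : G) (p : seq G) : bool := path adj v p && uniq (v :: p).

Definition path_verts (v : G) (p : seq G) : {set G} := [set x in v :: p].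

End Basics.

Definition critical (k : nat) (G : sgraph) : Prop :=
  [/\ graph_connected G,
      max_deg G = k,
      chromatic_index G = k.+1
    & forall e : {set G}, e \in edges G -> chromatic_index (del_edge e) = k].

(* The i-th distinguished path of a vertex v of degree k - 1 is
   [v :: p v i]; the values of p at other vertices are irrelevant. *)
Definition distinguished_paths (k t : nat) (G : sgraph)
    (p : G -> 'I_k.-1 -> seq G) : Prop :=
  let V v i := path_verts v (p v i) in
  forall v : G, v \in deg_class G k.-1 -> forall i j : 'I_k.-1,
  [/\ graph_path v (p v i),
      (V v i :&: deg_class G k.-1 = [set v])%SET,
      2 * t * k.-1 + 2 <= #|V v i|,
      (i != j -> V v i :&: V v j = [set v])%SET
    & forall w : G, w \in deg_class G k.-1 -> w != v ->
      (V v i :&: V w j = finset.set0)%SET].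

Arguments distinguished_paths k t {G} p.

Definition critical_paths (k t : nat) (G : sgraph) : Prop :=
  [/\ critical k G,
      k.-1 <= min_deg G
    & exists p : G -> 'I_k.-1 -> seq G, distinguished_paths k t p].

Local Open Scope classical_set_scope.
Local Open Scope ring_scope.

Definition indep_ratio (R : realType) (G : sgraph) : R :=
  (indep_num G)%:R / #|G|%:R.

(* Independence ratios lie in [0, 1], so these are suprema of bounded sets;
   the supremum of the empty set is 0. *)
Definition sup_ratio (R : realType) (k : nat) : R :=
  sup [set x : R | exists2 G : sgraph, critical k G & x = indep_ratio R G].

Definition sup_ratio_paths (R : realType) (k t : nat) : R :=
  sup [set x : R | exists2 G : sgraph, critical_paths k t G & x = indep_ratio R G].

(* Main.v *)
(** Idea (Meredith extension). Given a k-critical graph G, replace every vertex x by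
    a copy of the complete bipartite graph K_(k,k-1) and attach the edges at x to
    distinct vertices of the large side. In a k-coloring every color covers the small
    side of a copy, hence leaves the copy at most once; so contracting the copies
    gives a k-coloring of G, and conversely k-colorings of G - e are extended to the
    extension minus an edge by cyclic Latin rectangles. Thus the extension is
    k-critical again. Its minimum degree is at least k - 1, and taking the large side
    over an independent set and the small side elsewhere shows that an independence
    ratio above 1/2 stays above 1/2. Once the minimum degree is at least k - 1, the
    vertices of degree k - 1 correspond under a further extension, and paths starting
    there lift to longer ones that satisfy the same disjointness conditions. Iterating
    this turns any k-critical graph of ratio above 1/2 into one in C(k,t). *)

Require Import Defs.
From mathcomp Require Import classical_sets reals.
From mathcomp Require Import all_boot all_order all_algebra fingroup perm.

Set Implicit Arguments.
Unset Strict Implicit.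
Unset Printing Implicit Defensive.

(** * Proper colorings of a symmetric relation *)

(** Colors sit on ordered pairs and are constrained only on related ones. Colorings of a graph and
    of its edge-deleted subgraphs thus have the same type. *)
Definition proper_coloring (T C : Type) (e : rel T) (c : T -> T -> C) : Prop :=
  (forall x y, e x y -> c x y = c y x) /\
  (forall x y z, e x y -> e x z -> c x y = c x z -> y = z).

Lemma eq_set2l (T : finType) (x y z : T) : [set x; y] = [set x; z] -> y = z.
Proof.
move=> E; have := set22 x y; rewrite E !inE => /orP[/eqP yx|/eqP//].
by have := set22 x z; rewrite -E !inE yx orbb => /eqP.
Qed.

Lemma set2_inj (T : finType) (x y x' y' : T) :
  [set x; y] = [set x'; y'] -> (x = x' /\ y = y') \/ (x = y' /\ y = x').
Proof.
move=> E; have := set21 x y; rewrite E !inE => /orP[]/eqP xE; subst x.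
  by left; rewrite (eq_set2l E).
by right; rewrite [RHS]setUC in E; rewrite (eq_set2l E).
Qed.

(** * Edge colorings as functions on pairs of vertices *)

Section EdgeColoring.
Variable G : sgraph.

Lemma edgesP (e : {set G}) :
  reflect (exists2 u : G * G, adj u.1 u.2 & e = [set u.1; u.2]) (e \in edges G).
Proof.
apply: (iffP imsetP) => [[u]|[u uA ->]]; first by rewrite inE => uA ->; exists u.
by exists u; rewrite // inE.
Qed.

(** The palette is nonempty because a function on all pairs needs some value off the edges, while an
    edgeless graph is colorable with 0 colors. *)
Lemma edge_colorableP (m : nat) :
  edge_colorable G m.+1 <->
  exists c : G -> G -> 'I_m.+1, proper_coloring adj c.
Proof.
have eI (x y : G) : adj x y -> [set x; y] \in edges G.
  by move=> xy; apply/edgesP; exists (x, y).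
split=> [/existsP[c /forallP cP]|[c [csym cinj]]].
  exists (fun x y => oapp c ord0 (insub [set x; y] : option (edge_type G))).
  split=> [x y _|x y z xy xz]; first by rewrite setUC.
  rewrite (insubT (fun e => e \in edges G) (eI _ _ xy)).
  rewrite (insubT (fun e => e \in edges G) (eI _ _ xz)) /= => ceq.
  apply: (@eq_set2l _ x); apply/eqP/negPn/negP => ne.
  have /forallP := cP (Sub [set x; y] (eI _ _ xy) : {e | e \in edges G}).
  move/(_ (Sub [set x; z] (eI _ _ xz) : {e | e \in edges G})).
  rewrite ceq eqxx implybF negb_and -val_eqE /= ne /= negbK.
  by move/eqP/setP/(_ x); rewrite !inE eqxx.
(* [rep] picks one orientation of each edge; by symmetry of [c] the color [d] does not depend on the
   choice. *)
pose rep (e : edge_type G) := [pick u : G * G | adj u.1 u.2 && (val e == [set u.1; u.2])].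
pose d (e : edge_type G) := oapp (fun u => c u.1 u.2) ord0 (rep e).
have dE e x y : adj x y -> val e = [set x; y] -> d e = c x y.
  move=> xy eE; rewrite /d /rep; case: pickP => [[a b] /=|/(_ (x, y))]; last first.
    by rewrite /= xy eE eqxx.
  rewrite eE => /andP[ab /eqP E].
  have := set21 x y; rewrite E !inE => /orP[] /eqP xE; subst x.
    by rewrite (eq_set2l E).
  by rewrite csym //; rewrite [RHS]setUC in E; rewrite (eq_set2l E).
apply/existsP; exists [ffun e => d e]; apply/forallP => e; apply/forallP => f; apply/implyP.
case/andP=> ef /set0Pn[x]; rewrite !inE !ffunE => /andP[xe xf].
have inc (g : edge_type G) : x \in val g -> exists2 y, adj x y & val g = [set x; y].
  have /edgesP[[a b] /= ab gE] := valP g; rewrite gE !inE => /orP[]/eqP->.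
    by exists b.
  by exists a; rewrite 1?adj_sym // setUC.
have [y xy eE] := inc _ xe; have [z xz fE] := inc _ xf.
rewrite (dE _ _ _ xy eE) (dE _ _ _ xz fE); apply: contra_neq ef.
by move/(cinj _ _ _ xy xz) => yz; apply: val_inj; rewrite eE fE yz.
Qed.

Lemma chromatic_index_leP (m : nat) :
  chromatic_index G <= m.+1 <->
  exists c : G -> G -> 'I_m.+1, proper_coloring adj c.
Proof.
rewrite -edge_colorableP /chromatic_index; case: ex_minnP => q qc qmin.
split=> [qm|/qmin//]; case/existsP: qc => c /forallP cP.
apply/existsP; exists [ffun e => widen_ord qm (c e)].
apply/forallP => e; apply/forallP => f; have /forallP/(_ f) := cP e.
case: (_ && _) => //=; rewrite !ffunE; apply: contra_neq => E.
by apply: val_inj; have /(congr1 val) := E.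
Qed.

(* The deleted edge gets a new color. *)
Lemma proper_coloring_undelete (e : {set G}) (m : nat) (c : G -> G -> 'I_m) :
  proper_coloring (del_adj e) c ->
  exists c' : G -> G -> 'I_m.+1, proper_coloring adj c'.
Proof.
case=> csym cinj.
exists (fun x y => if [set x; y] == e then ord_max else widen_ord (leqnSn m) (c x y)).
have neq (i : 'I_m) : ord_max <> widen_ord (leqnSn m) i.
  by move/(congr1 val) => /= E; have := ltn_ord i; rewrite -E ltnn.
split=> [x y xy|x y z xy xz].
  rewrite setUC; case: ifPn => // ne.
  by rewrite csym // /del_adj xy setUC.
case: ifPn => [/eqP ey|ey]; case: ifPn => [/eqP ez|ez].
- by move=> _; apply: (@eq_set2l _ x); rewrite ey ez.
- by move/neq.
- by move/esym/neq.
- move/(congr1 val) => /= /val_inj; apply: cinj; first by rewrite /del_adj xy.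
  by rewrite /del_adj xz.
Qed.

(* A color missing at both ends of the deleted edge could be given to it. *)
Lemma missing_colors_neq (u v : G) (m : nat) (c : G -> G -> 'I_m.+1) (a b : 'I_m.+1) :
  proper_coloring (del_adj [set u; v]) c -> m.+1 < chromatic_index G ->
  (forall w, del_adj [set u; v] u w -> c u w != a) ->
  (forall w, del_adj [set u; v] v w -> c v w != b) -> a != b.
Proof.
move=> [csym cinj]; rewrite ltnNge => /negP nc au bv.
apply/eqP => ab; subst b; apply/nc/chromatic_index_leP.
exists (fun x y => if [set x; y] == [set u; v] then a else c x y).
have av x y z : [set x; y] = [set u; v] -> del_adj [set u; v] x z -> c x z != a.
  by move=> E; have := set21 x y; rewrite E !inE => /orP[]/eqP->; [apply: au|apply: bv].
split=> [x y xy|x y z xy xz].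
  by rewrite setUC; case: ifPn => // ne; rewrite csym // /del_adj xy setUC.
case: ifPn => [/eqP ey|ey]; case: ifPn => [/eqP ez|ez].
- by move=> _; apply: (@eq_set2l _ x); rewrite ey ez.
- by move/esym => E; have := av _ _ z ey; rewrite /del_adj xz ez E eqxx => /(_ isT).
- by move=> E; have := av _ _ y ez; rewrite /del_adj xy ey E eqxx => /(_ isT).
- by apply: cinj; rewrite /del_adj ?xy ?xz.
Qed.

End EdgeColoring.

(** Used to relabel rows or colors of Latin rectangles. The permutation is built one point at a
    time. *)
Lemma perm_extension (T I : finType) (g f : T -> I) (D : {set T}) :
  {in D &, injective g} -> {in D &, injective f} ->
  exists s : {perm I}, {in D, forall w, s (g w) = f w}.
Proof.
have [r rD] : exists r : seq T, r =i D by exists (enum D) => x; rewrite mem_enum.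
move=> gi fi.
suff H r' : uniq r' -> {subset r' <= D} ->
    exists s : {perm I}, {in r', forall w, s (g w) = f w}.
  have [|w|s sP] := H (undup r); first exact: undup_uniq.
    by rewrite mem_undup rD.
  by exists s => w wD; apply: sP; rewrite mem_undup rD.
elim: r' => [|x r' IH] /=; first by exists 1%g.
case/andP=> xr ur sub.
have [//|w wr|s sP] := IH; first by apply: sub; rewrite inE wr orbT.
(* The transposition sends the old image of [g x] to [f x]; by injectivity of [g] and [f] it fixes
   the images already prescribed. *)
exists (s * tperm (s (g x)) (f x))%g => w; rewrite inE permM.
have xD : x \in D by apply: sub; rewrite mem_head.
case/predU1P => [->|wr]; first by rewrite tpermL.
have wD : w \in D by apply: sub; rewrite inE wr orbT.
have nwx : x <> w by move=> E; rewrite E wr in xr.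
rewrite -(sP _ wr) tpermD //; apply/eqP.
  by move/perm_inj/gi => /(_ xD wD).
by rewrite sP // => /fi => /(_ xD wD).
Qed.

(** * Latin rectangles *)

Section LatinRectangle.
Variable n : nat.
Implicit Types (a : 'I_n.+1) (b : 'I_n) (q : 'I_n.+1 -> 'I_n -> 'I_n.+1).

(** A proper coloring of K_(n+1,n) with n+1 colors. Each row misses exactly one color, which is left
    for the edge leaving the copy there. *)
Definition latin q : Prop :=
  (forall a, injective (q a)) /\ (forall b, injective (q^~ b)).

Lemma latin_col_perm q (s : {perm 'I_n}) : latin q -> latin (fun a b => q a (s b)).
Proof.
by case=> qr qc; split=> [a b b' /qr/perm_inj|b a a' /qc].
Qed.

(** In the cyclic rectangle the row of a color consists of its translates by nonzero amounts, hence
    misses that color; [s] assigns row [g w] to color [f w]. The renaming [phi] of the colors is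
    kept free so that single entries can be controlled. *)
Lemma latin_avoid (T : finType) (D : {set T}) (g f : T -> 'I_n.+1) (phi : {perm 'I_n.+1}) :
  {in D &, injective g} -> {in D &, injective f} ->
  exists2 q, latin q & {in D, forall w, forall b,
    phi (q (g w) b) = (phi (f w) + lift ord0 b)%R /\ q (g w) b != f w}.
Proof.
move=> gi fi; have [s sP] := perm_extension gi fi.
pose q a b := (phi^-1)%g (phi (s a) + lift ord0 b)%R.
have Q a b : phi (q a b) = (phi (s a) + lift ord0 b)%R by rewrite permKV.
exists q; first split=> [a b b'|b a a'].
- by move/(congr1 phi); rewrite !Q => /GRing.addrI/lift_inj.
- by move/(congr1 phi); rewrite !Q => /GRing.addIr/perm_inj/perm_inj.
move=> w wD b; rewrite Q sP //; split=> //; apply/eqP => /(congr1 phi).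
rewrite Q sP // -[RHS]GRing.addr0 => /GRing.addrI /eqP.
by rewrite -val_eqE.
Qed.

(** Row [g w0] contains every color but [f w0], so [z] occurs in it, and a swap of columns brings it
    to [b0]. *)
Lemma latin_avoid1 (T : finType) (D : {set T}) (g f : T -> 'I_n.+1)
    (w0 : T) b0 (z : 'I_n.+1) :
  {in D &, injective g} -> {in D &, injective f} -> w0 \in D -> z != f w0 ->
  exists q, [/\ latin q, {in D, forall w, forall b, q (g w) b != f w} & q (g w0) b0 = z].
Proof.
move=> gi fi w0D zf; have [q ql qP] := latin_avoid 1%g gi fi.
have [b bz] : exists b, q (g w0) b = z.
  have : z \in [set q (g w0) b | b : 'I_n].
    suff -> : [set q (g w0) b | b : 'I_n] = ~: [set f w0] by rewrite !inE.
    apply/eqP; rewrite eqEcard; apply/andP; split.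
      by apply/subsetP=> _ /imsetP[b _ ->]; rewrite !inE; have [] := qP _ w0D b.
    rewrite cardsC1 card_imset ?card_ord //; exact: (proj1 ql).
  by case/imsetP=> b _ ->; exists b.
exists (fun a b' => q a (tperm b0 b b')); split.
- exact: latin_col_perm.
- by move=> w wD b'; have [] := qP _ wD (tperm b0 b b').
- by rewrite tpermL.
Qed.

(** If [phi] numbers [f w0], [f w1], [z] as 0, 1, 2, then the column of shift 1 has [f w1] in row
    [g w0] and [z] in row [g w1]. Three distinct colors force n to be at least 2, so nothing wraps
    around. *)
Lemma latin_avoid2 (T : finType) (D : {set T}) (g f : T -> 'I_n.+1)
    (w0 w1 : T) b0 (z : 'I_n.+1) :
  {in D &, injective g} -> {in D &, injective f} -> w0 \in D -> w1 \in D ->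
  w0 != w1 -> z != f w0 -> z != f w1 ->
  exists q, [/\ latin q, {in D, forall w, forall b, q (g w) b != f w},
    q (g w1) b0 = z & q (g w0) b0 = f w1].
Proof.
move=> gi fi w0D w1D w01 z0 z1.
have f01 : f w0 != f w1 by apply: contra_neq w01; apply: fi.
have n2 : 2 < n.+1.
  rewrite -[n.+1]card_ord; have <- : #|[set z; f w0; f w1]| = 3.
    by rewrite -finset.setUA cardsU1 cards2 !inE negb_or z0 z1 f01.
  exact: max_card.
pose g3 (i : 'I_3) := nth z [:: f w0; f w1; z] i.
have g3i : {in [set: 'I_3] &, injective g3}.
  move=> x y _ _ /eqP; rewrite nth_uniq ?ltn_ord //; first by move/eqP/val_inj.
  by rewrite /= !inE negb_or f01 [f w0 == _]eq_sym z0 [f w1 == _]eq_sym z1.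
have f3i : {in [set: 'I_3] &, injective (widen_ord n2)}.
  by move=> x y _ _ [] /val_inj.
have [phi phiP] := perm_extension g3i f3i.
have p0 := phiP ord0 (in_setT _); have p2 := phiP ord_max (in_setT _).
have p1 := phiP (Ordinal (isT : 1 < 3)) (in_setT _); move=> {phiP}.
rewrite /= in p0 p1 p2.
have n0 : 0 < n by rewrite -ltnS ltnW.
pose j : 'I_n := Ordinal n0.
have [q ql qP] := latin_avoid phi gi fi.
(* Column [j] is the one of shift 1; it is swapped with [b0]. *)
have lj : val (lift ord0 j) = 1 by [].
exists (fun a b' => q a (tperm b0 j b')); split.
- exact: latin_col_perm.
- by move=> w wD b'; have [] := qP _ wD (tperm b0 j b').
- rewrite tpermL; apply: (@perm_inj _ phi); rewrite (proj1 (qP _ w1D j)) p1 p2.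
  by apply: val_inj => /=; rewrite modn_small.
- rewrite tpermL; apply: (@perm_inj _ phi); rewrite (proj1 (qP _ w0D j)) p0 p1.
  by apply: val_inj => /=; rewrite modn_small // ltnW.
Qed.

End LatinRectangle.

(** * Missing colors and vertex degrees *)

Lemma missing_color (T C : finType) (D : {set T}) (h : T -> C) :
  #|D| < #|C| -> exists z, {in D, forall w, h w != z}.
Proof.
move=> DC; have /card_gt0P[z] : 0 < #|~: (h @: D)|.
  by rewrite cardsCs setCK subn_gt0 (leq_ltn_trans (leq_imset_card _ _)).
by rewrite inE => zP; exists z => w wD; apply: contraNneq zP => <-; apply: imset_f.
Qed.

Lemma missing_color2 (T C : finType) (D : {set T}) (h : T -> C) :
  #|D|.+1 < #|C| ->
  exists z1 z2, [/\ z1 != z2, {in D, forall w, h w != z1} & {in D, forall w, h w != z2}].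
Proof.
move=> DC; have /card_gt1P[z1 [z2 []]] : 1 < #|~: (h @: D)|.
  by rewrite cardsCs setCK ltn_subRL addn1 (leq_ltn_trans _ DC) // ltnS leq_imset_card.
rewrite !inE => z1P z2P z12; exists z1, z2; split=> // w wD.
  by apply: contraNneq z1P => <-; apply: imset_f.
by apply: contraNneq z2P => <-; apply: imset_f.
Qed.

Section DeletedEdge.
Variable G : sgraph.

Lemma del_adjE (u v w : G) : del_adj [set u; v] u w = adj u w && (w != v).
Proof.
rewrite /del_adj; congr (_ && ~~ _); apply/eqP/eqP => [/eq_set2l//|->//].
Qed.

Lemma card_del_nbrs (u v : G) : adj u v ->
  #|[set w | del_adj [set u; v] u w]|.+1 = deg u.
Proof.
move=> uv; rewrite /deg [in RHS](cardsD1 v) [v \in _]inE uv; congr _.+1.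
by apply: eq_card => w; rewrite !inE del_adjE andbC.
Qed.

Lemma deg_le_max (v : G) : deg v <= max_deg G.
Proof. exact: (leq_bigmax_cond (F := @deg G)). Qed.

Lemma min_deg_le (v : G) : min_deg G <= deg v.
Proof.
rewrite /min_deg; have := mem_index_enum v; elim: (index_enum G) => //= x s IH.
rewrite inE big_cons geq_min => /predU1P[->|/IH->]; first by rewrite leqnn.
by rewrite orbT.
Qed.

End DeletedEdge.

(** * The Meredith extension *)

Section Meredith.
Variables (G : sgraph) (n : nat).

(** The neighbors of [v] are numbered in the order of enumeration. For adjacent [u] the default of
    [inord] is met only if the degree of [v] exceeds n+1. *)
Definition port (v u : G) : 'I_n.+1 := inord (index u (enum [set w | adj v w])).

Lemma port_inj (v : G) : max_deg G <= n.+1 ->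
  {in [set w | adj v w] &, injective (port v)}.
Proof.
move=> Gn x y xv yv /(congr1 val) /=.
have lt z : z \in [set w | adj v w] -> index z (enum [set w | adj v w]) < n.+1.
  move=> zv; apply: leq_trans (leq_trans (deg_le_max v) Gn).
  by rewrite /deg cardE index_mem mem_enum.
by rewrite !inordK ?lt // => /(index_inj v) H; apply: H; rewrite mem_enum.
Qed.

Definition meredith_adj : rel (G * ('I_n.+1 + 'I_n)) := fun p q =>
  match p.2, q.2 with
  | inl a, inl b => [&& adj p.1 q.1, a == port p.1 q.1 & b == port q.1 p.1]
  | inl _, inr _ | inr _, inl _ => p.1 == q.1
  | inr _, inr _ => false
  end.

Lemma meredith_adj_sym : symmetric meredith_adj.
Proof.
move=> [x [a|b]] [y [a'|b']]; rewrite /meredith_adj //= ?[x == y]eq_sym //.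
by rewrite adj_sym [(_ == _) && _]andbC.
Qed.

Lemma meredith_adj_irr : irreflexive meredith_adj.
Proof. by move=> [x [a|b]]; rewrite /meredith_adj //= adj_irr. Qed.

(* Each vertex x is replaced by a copy of K_(n+1,n); the edge xy of G then joins
   the vertices (x, inl (port x y)) and (y, inl (port y x)). *)
Definition meredith : sgraph := SGraph meredith_adj_sym meredith_adj_irr.

Notation A x a := ((x, inl a) : meredith).
Notation B x b := ((x, inr b) : meredith).

Lemma adj_ports x y : adj x y -> adj (A x (port x y)) (A y (port y x)).
Proof. by rewrite /= /meredith_adj /= !eqxx !andbT. Qed.

Lemma adj_inner x a b : adj (A x a) (B x b).
Proof. by rewrite /= /meredith_adj /= eqxx. Qed.

(* Every color class covers the n small-side vertices of each copy of
   K_(n+1,n), so it is present on at most one edge leaving the copy. *)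
Lemma coloring_of_meredith (c : meredith -> meredith -> 'I_n.+1) :
  max_deg G <= n.+1 -> proper_coloring adj c ->
  exists c' : G -> G -> 'I_n.+1, proper_coloring adj c'.
Proof.
move=> Gn [csym cinj].
exists (fun x y => c (A x (port x y)) (A y (port y x))).
split=> [x y /adj_ports/csym//|x y z xy xz cE]; apply/eqP/negPn/negP => yz.
set z0 := c _ _ in cE.
have /fin_all_exists[g gP] b : exists a, c (B x b) (A x a) = z0.
  have ci : injective (fun a => c (B x b) (A x a)).
    move=> a a' E; have adjB a1 : adj (B x b) (A x a1) by rewrite adj_sym adj_inner.
    by have [] := cinj _ _ _ (adjB a) (adjB a') E.
  by exists (invF ci z0); rewrite (f_invF ci).
have gi : injective g.
  move=> b b' gE; have := gP b; rewrite -(gP b') gE.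
  rewrite -!(csym (A x _)) ?adj_inner // => E.
  by have [] := cinj _ _ _ (adj_inner _ _ _) (adj_inner _ _ _) E.
have gport w : adj x w -> c (A x (port x w)) (A w (port w x)) = z0 ->
    port x w \notin [set g b | b in 'I_n].
  move=> xw cw; apply/negP => /imsetP[b _ pE].
  have := gP b; rewrite -csym ?adj_inner // -pE -cw => E.
  by have := cinj _ _ _ (adj_inner _ _ _) (adj_ports xw) E.
(* The n values of [g] and the two ports would be n+2 distinct elements of ['I_n.+1]. *)
have : #|port x y |: (port x z |: [set g b | b in 'I_n])| <= n.+1.
  by rewrite -[X in _ <= X]card_ord max_card.
rewrite !cardsU1 card_imset // card_ord !inE negb_or !gport // andbT.
have -> : port x y != port x z.
  by apply: contraNneq yz => /(port_inj Gn) -> //; rewrite inE.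
by rewrite ltnn.
Qed.

(** Assembles a coloring from [o] on the edges between copies and the arrays [q x] inside them. All
    conditions spare the deleted edge [e], whichever kind it is. *)
Lemma meredith_coloring (e : {set meredith}) (o : G -> G -> 'I_n.+1)
    (q : G -> 'I_n.+1 -> 'I_n -> 'I_n.+1) :
  max_deg G <= n.+1 ->
  let in_keep x a b := [set A x a; B x b] != e in
  let out_keep x y := [set A x (port x y); A y (port y x)] != e in
  (forall x y, adj x y -> out_keep x y -> o x y = o y x) ->
  (forall x a b b', in_keep x a b -> in_keep x a b' -> q x a b = q x a b' -> b = b') ->
  (forall x a a' b, in_keep x a b -> in_keep x a' b -> q x a b = q x a' b -> a = a') ->
  (forall x y b, adj x y -> out_keep x y -> in_keep x (port x y) b ->
     q x (port x y) b != o x y) ->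
  exists c : meredith -> meredith -> 'I_n.+1, proper_coloring (@del_adj meredith e) c.
Proof.
move=> Gn in_keep out_keep osym qrow qcol qo.
exists (fun p r => match p.2, r.2 with
  | inl _, inl _ => o p.1 r.1
  | inl a, inr b | inr b, inl a => q p.1 a b
  | inr _, inr _ => ord0
  end); split=> [[x [a|b]] [y [a'|b']]|[x [a|b]] [y [a'|b']] [z [a''|b'']]];
  rewrite /del_adj /= /meredith_adj //=.
- by case/andP=> /and3P[xy /eqP-> /eqP->]; apply: osym.
- by case/andP=> /eqP->.
- by case/andP=> /eqP->.
- case/andP=> /and3P[xy /eqP-> /eqP->] _ /andP[/and3P[xz /eqP pE /eqP->] _] _.
  by rewrite (port_inj Gn _ _ pE) ?inE.
- case/andP=> /and3P[xy /eqP-> /eqP->] k /andP[/eqP<- k'] E.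
  by have := qo _ _ _ xy k k'; rewrite E eqxx.
- case/andP=> /eqP<- k /andP[/and3P[xz /eqP aE /eqP->] k'] E; subst a.
  by have := qo _ _ _ xz k' k; rewrite E eqxx.
- by case/andP=> /eqP<- k /andP[/eqP<- k'] /(qrow _ _ _ _ k k') ->.
- case/andP=> /eqP<- k /andP[/eqP<- k'] E; rewrite setUC in k.
  by rewrite setUC in k'; rewrite (qcol _ _ _ _ k k' E).
Qed.

End Meredith.

(** * Coloring the extension minus an edge *)

Section MeredithDeletion.
Variables (G : sgraph) (n : nat).
Hypothesis Gn : max_deg G <= n.+1.

Local Notation M := (meredith G n).
Local Notation A x a := ((x, inl a) : M).
Local Notation B x b := ((x, inr b) : M).

(** The edges between copies keep their colors from [c], and each copy gets a Latin rectangle whose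
    row at a port misses the color leaving there. *)
Lemma meredith_del_outer (u v : G) (c : G -> G -> 'I_n.+1) :
  proper_coloring (del_adj [set u; v]) c ->
  exists c' : M -> M -> 'I_n.+1,
    proper_coloring (@del_adj M [set A u (port n u v); A v (port n v u)]) c'.
Proof.
case=> csym cinj; pose N x := [set w | del_adj [set u; v] x w].
have keep x y : adj x y -> [set A x (port n x y); A y (port n y x)] !=
    [set A u (port n u v); A v (port n v u)] -> del_adj [set u; v] x y.
  move=> xy; rewrite /del_adj xy /=; apply: contraNneq => /set2_inj[] [-> ->] //.
  by rewrite setUC.
have /fin_all_exists[q qP] x : exists q, latin q /\
    {in N x, forall w b, q (port n x w) b != c x w}.
  have [w y| w y|q ql qP] := @latin_avoid n _ (N x) (port n x) (c x) 1%g.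
  - rewrite !inE => /andP[xw _] /andP[xy _].
    by apply: (port_inj Gn); rewrite inE.
  - by rewrite !inE; apply: cinj.
  - by exists q; split=> // w wN b; have [] := qP w wN b.
apply: (meredith_coloring (o := c) (q := q) Gn).
- by move=> x y xy /(keep _ _ xy); apply: csym.
- by move=> x a b b' _ _; apply: (proj1 (proj1 (qP x))).
- by move=> x a a' b _ _; apply: (proj2 (proj1 (qP x))).
- by move=> x y b xy /(keep _ _ xy) k _; apply: (proj2 (qP x)); rewrite inE.
Qed.

(* The edge uv gets the color z, which is missing at u but may be present at v;
   it then remains to color the copy of K_(n+1,n) at v. *)
Lemma meredith_del_inner (v u : G) (a0 : 'I_n.+1) (b0 : 'I_n) (z : 'I_n.+1)
    (c : G -> G -> 'I_n.+1) (q0 : 'I_n.+1 -> 'I_n -> 'I_n.+1) :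
  let keep a b := (a, b) != (a0, b0) in
  proper_coloring (del_adj [set v; u]) c ->
  (forall w, del_adj [set v; u] u w -> c u w != z) ->
  (forall a b b', keep a b -> keep a b' -> q0 a b = q0 a b' -> b = b') ->
  (forall a a' b, keep a b -> keep a' b -> q0 a b = q0 a' b -> a = a') ->
  (forall w b, adj v w -> keep (port n v w) b ->
     q0 (port n v w) b != if w == u then z else c v w) ->
  exists c' : M -> M -> 'I_n.+1, proper_coloring (@del_adj M [set A v a0; B v b0]) c'.
Proof.
move=> keep [csym cinj] zu q0row q0col q0avoid.
pose o x y := if [set x; y] == [set v; u] then z else c x y.
have osym x y : adj x y -> o x y = o y x.
  rewrite /o [[set y; x]]setUC => xy; case: ifPn => // ne.
  by rewrite csym // /del_adj xy.
have ov w : o v w = if w == u then z else c v w.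
  rewrite /o; congr (if _ then _ else _).
  by apply/eqP/eqP => [/eq_set2l|->].
(* Away from [v] only [u] sees the new color [z], which is missing there, so [o] is still proper at
   these vertices. *)
have oi x : x != v -> {in [set w | adj x w] &, injective (o x)}.
  move=> xv w y; rewrite !inE => xw xy; rewrite /o.
  have xE t : [set x; t] = [set v; u] -> x = u.
    by case/set2_inj => [] [] // xE; rewrite xE eqxx in xv.
  have zx t r : [set x; t] = [set v; u] -> del_adj [set v; u] x r -> c x r != z.
    by move/xE->; apply: zu.
  case: ifPn => [/eqP ew|ew]; case: ifPn => [/eqP ey|ey] E.
  - by apply: (@eq_set2l _ x); rewrite ew ey.
  - by have := zx _ y ew; rewrite /del_adj xy ey E eqxx => /(_ isT).
  - by have := zx _ w ey; rewrite /del_adj xw ew E eqxx => /(_ isT).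
  - by apply: cinj E; rewrite /del_adj ?xw ?xy.
have /fin_all_exists[q qP] x : exists q, x != v -> latin q /\
    {in [set w | adj x w], forall w b, q (port n x w) b != o x w}.
  (* A placeholder at [v], where [q0] is going to be used. *)
  have [->|xv] := eqVneq x v; first by exists (fun _ _ => ord0).
  have [q ql qP] := latin_avoid 1%g (@port_inj G n x Gn) (oi x xv).
  by exists q => _; split=> // w wN b; have [] := qP w wN b.
have kE a b : [set A v a; B v b] != [set A v a0; B v b0] -> keep a b.
  by apply: contra_neq => -[-> ->].
apply: (meredith_coloring (o := o) (q := fun x => if x == v then q0 else q x) Gn).
- by move=> x y xy _; apply: osym.
- move=> x a b b'; have [->|xv] := eqVneq x v.
    by move=> /kE k /kE k'; apply: q0row.
  by move=> _ _; apply: (proj1 (proj1 (qP x xv))).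
- move=> x a a' b; have [->|xv] := eqVneq x v.
    by move=> /kE k /kE k'; apply: q0col.
  by move=> _ _; apply: (proj2 (proj1 (qP x xv))).
- move=> x y b; have [->|xv] := eqVneq x v.
    by move=> vy _ /kE k; rewrite ov; apply: q0avoid.
  by move=> xy _ _; apply: (proj2 (qP x xv)); rewrite inE.
Qed.

Hypothesis Gchi : n.+1 < chromatic_index G.
Hypothesis Gdel : forall u v : G, adj u v ->
  exists c : G -> G -> 'I_n.+1, proper_coloring (del_adj [set u; v]) c.

Lemma missing_at_end (u v : G) (c : G -> G -> 'I_n.+1) : adj u v ->
  exists z, forall w, del_adj [set u; v] u w -> c u w != z.
Proof.
move=> uv; have [|z zP] := @missing_color _ _ [set w | del_adj [set u; v] u w] (c u).
  by rewrite card_del_nbrs // card_ord (leq_trans (deg_le_max u)).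
by exists z => w uw; apply: zP; rewrite inE.
Qed.

(** Let [y] be missing at [v] and [z] at [u]. A rectangle for [v] that treats [vu] as colored [y]
    can be given the entry [z] at the deleted edge. Then [z] no longer occurs at this port and can
    color the edge leaving it. *)
Lemma meredith_del_inner_port (v u : G) (b0 : 'I_n) : adj v u ->
  exists c' : M -> M -> 'I_n.+1,
    proper_coloring (@del_adj M [set A v (port n v u); B v b0]) c'.
Proof.
move=> vu; have [c cP] := Gdel vu.
have [y yP] := missing_at_end c vu.
have uv : adj u v by rewrite adj_sym.
have [z] := missing_at_end c uv; rewrite setUC => zP.
have yz : y != z := missing_colors_neq cP Gchi yP zP.
pose f w := if w == u then y else c v w.
have fi : {in [set w | adj v w] &, injective f}.
  move=> w w'; rewrite !inE /f => vw vw'.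
  case: (eqVneq w u) => [->|wu]; case: (eqVneq w' u) => [->|w'u] // E.
  - by have := yP w'; rewrite del_adjE vw' w'u E eqxx => /(_ isT).
  - by have := yP w; rewrite del_adjE vw wu E eqxx => /(_ isT).
  - by apply: (proj2 cP) E; rewrite del_adjE ?vw ?vw'.
have [||q [ql qf qz]] := latin_avoid1 (w0 := u) b0 (z := z) (@port_inj G n v Gn) fi.
- by rewrite inE.
- by rewrite /f eqxx eq_sym.
apply: (meredith_del_inner (q0 := q) cP zP).
- by move=> a b b' _ _; apply: (proj1 ql).
- by move=> a a' b _ _; apply: (proj2 ql).
- move=> w b vw; case: (eqVneq w u) => [->|wu].
    by apply: contra_neq; rewrite -qz => /(proj1 ql) ->.
  by move=> _; have := qf w; rewrite inE /f (negPf wu); apply.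
Qed.

(* Here the degree of v is less than n + 1, so two colors y1 and y2 are missing
   at v. In a coloring of K_(n+1,n) whose entries at (port v u, b0) and (a0, b0)
   are z and y1, deleting the latter makes it possible to turn the former into
   y1, which frees z for the edge vu. *)
Lemma meredith_del_inner_free (v u : G) (a0 : 'I_n.+1) (b0 : 'I_n) : adj v u ->
  (forall w, adj v w -> port n v w != a0) ->
  exists c' : M -> M -> 'I_n.+1,
    proper_coloring (@del_adj M [set A v a0; B v b0]) c'.
Proof.
move=> vu a0P; have [c cP] := Gdel vu.
(* The free port [a0] bounds the degree of [v] by n, so at most n-1 colors remain at [v] once [vu]
   is deleted. *)
have [|y1 [y2 [y12 y1P y2P]]] :=
    @missing_color2 _ _ [set w | del_adj [set v; u] v w] (c v).
  rewrite card_del_nbrs // card_ord ltnS /deg -(card_in_imset (@port_inj G n v Gn)).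
  apply: (@leq_trans #|~: [set a0]|); last by rewrite cardsC1 card_ord.
  apply: subset_leq_card; apply/subsetP => _ /imsetP[w wN ->]; rewrite !inE in wN *.
  exact: a0P.
have {}y1P w : del_adj [set v; u] v w -> c v w != y1 by move=> vw; apply: y1P; rewrite inE.
have {}y2P w : del_adj [set v; u] v w -> c v w != y2 by move=> vw; apply: y2P; rewrite inE.
have uv : adj u v by rewrite adj_sym.
have [z] := missing_at_end c uv; rewrite setUC => zP.
have y1z : y1 != z := missing_colors_neq cP Gchi y1P zP.
have y2z : y2 != z := missing_colors_neq cP Gchi y2P zP.
(* [None] stands for the free port [a0], as if an edge of color [y2] left there; [vu] is treated as
   colored [y1]. *)
pose D := [set w : option G | oapp (adj v) true w].
pose g w := oapp (port n v) a0 w.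
pose f w := oapp (fun w => if w == u then y1 else c v w) y2 w.
have gi : {in D &, injective g}.
  move=> [w|] [w'|]; rewrite !inE //= => vw vw' E.
  - by congr Some; apply: (port_inj Gn) E; rewrite inE.
  - by have := a0P _ vw; rewrite E eqxx.
  - by have := a0P _ vw'; rewrite E eqxx.
have fi : {in D &, injective f}.
  move=> [w|] [w'|]; rewrite !inE /f //= => vw vw'.
  - case: (eqVneq w u) => [->|wu]; case: (eqVneq w' u) => [->|w'u] // E.
    + by have := y1P w'; rewrite del_adjE vw' w'u E eqxx => /(_ isT).
    + by have := y1P w; rewrite del_adjE vw wu E eqxx => /(_ isT).
    + by congr Some; apply: (proj2 cP) E; rewrite del_adjE ?vw ?vw'.
  - case: (eqVneq w u) => [_|wu] E; first by rewrite E eqxx in y12.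
    by have := y2P w; rewrite del_adjE vw wu E eqxx => /(_ isT).
  - case: (eqVneq w' u) => [_|w'u] E; first by rewrite E eqxx in y12.
    by have := y2P w'; rewrite del_adjE vw' w'u E eqxx => /(_ isT).
have [|||||q [ql qf qz qy]] := latin_avoid2 (w0 := None) (w1 := Some u) b0 (z := z) gi fi.
- by rewrite inE.
- by rewrite inE.
- by [].
- by rewrite /f /= eq_sym.
- by rewrite /f /= eqxx eq_sym.
rewrite /g /f /= eqxx in qz qy.
have qu b : q (port n v u) b != y1.
  by have := qf (Some u); rewrite inE /g /f /= eqxx; apply.
apply: (meredith_del_inner
  (q0 := fun a b => if (a, b) == (port n v u, b0) then y1 else q a b) cP zP).
- move=> a b b' _ _; rewrite !xpair_eqE; case: (eqVneq a (port n v u)) => [->|_] /=.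
    case: (eqVneq b b0) => [->|_]; case: (eqVneq b' b0) => [->|_] // E.
    + by have := qu b'; rewrite E eqxx.
    + by have := qu b; rewrite E eqxx.
    + exact: (proj1 ql) E.
  exact: (proj1 ql).
(* In column [b0] the color [y1] stood only in row [a0], at the deleted edge. *)
- move=> a a' b; rewrite !xpair_eqE; case: (eqVneq b b0) => [->|_] /=.
    rewrite !andbT; case: (eqVneq a (port n v u)) => [->|_];
      case: (eqVneq a' (port n v u)) => [->|_] // ka ka' E.
    + by move: ka'; rewrite -qy in E; rewrite (proj2 ql _ _ _ E) eqxx.
    + by move: ka; rewrite -qy in E; rewrite (proj2 ql _ _ _ E) eqxx.
    + exact: (proj2 ql) E.
  by rewrite !andbF => _ _; apply: (proj2 ql).
- move=> w b vw _; rewrite xpair_eqE; case: (eqVneq w u) => [->|wu].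
    rewrite eqxx /=; case: (eqVneq b b0) => [_|bb0] //.
    by apply: contra_neq bb0; rewrite -qz => /(proj1 ql) ->.
  have -> : (port n v w == port n v u) = false.
    by apply: contra_neqF wu => /eqP/(port_inj Gn) -> //; rewrite inE.
  by have := qf (Some w); rewrite inE /g /f /= (negPf wu); apply.
Qed.

Lemma meredith_del_colorable (e : {set M}) :
  (forall v : G, exists u, adj v u) -> e \in edges M ->
  exists c' : M -> M -> 'I_n.+1, proper_coloring (@del_adj M e) c'.
Proof.
move=> nbr /edgesP[[p r] /= pr ->].
have inner v a b : exists c' : M -> M -> 'I_n.+1,
    proper_coloring (@del_adj M [set A v a; B v b]) c'.
  have [/existsP[u /andP[vu /eqP<-]]|] := boolP [exists u, adj v u && (port n v u == a)].
    exact: meredith_del_inner_port.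
  (* At a free port any edge at [v] may be the one deleted from [G]. *)
  rewrite negb_exists => /forallP free; have [u vu] := nbr v.
  by apply: (meredith_del_inner_free _ vu) => w vw; have := free w; rewrite vw.
case: p r pr => [x [a|b]] [y [a'|b']]; rewrite /meredith_adj //=.
- case/and3P=> xy /eqP-> /eqP->; have [c cP] := Gdel xy.
  exact: (meredith_del_outer cP).
- by move/eqP<-.
- by move/eqP<-; rewrite setUC.
Qed.

End MeredithDeletion.

(** * Degrees and connectivity of the extension *)

Section MeredithDegrees.
Variables (G : sgraph) (n : nat).
Hypothesis Gn : max_deg G <= n.+1.

Local Notation M := (meredith G n).
Local Notation A x a := ((x, inl a) : M).
Local Notation B x b := ((x, inr b) : M).

Lemma deg_meredith_inr x b : deg (B x b) = n.+1.
Proof.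
rewrite -[RHS]card_ord -(card_imset (f := fun a => A x a)) => [|a a' [->]//].
apply: eq_card => -[y [a|b']]; rewrite inE /= /meredith_adj /=.
  by apply/eqP/imsetP => [->|[a' _ [-> _]]//]; exists a.
by apply/esym/imsetP => -[].
Qed.

Lemma deg_meredith_inl x a :
  deg (A x a) = n + #|[set u | adj x u && (port n x u == a)]|.
Proof.
set U := [set u | _].
pose SB := [set B x b | b : 'I_n]; pose SA := [set A u (port n u x) | u in U].
have -> : deg (A x a) = #|SB :|: SA|.
  apply: eq_card => -[y [a'|b]]; rewrite !inE /= /meredith_adj /=.
    have -> : (y, inl a') \in SB = false by apply/imsetP => -[].
    apply/and3P/imsetP => [[xy /eqP aE /eqP->]|[u]].
      by exists y; rewrite // inE xy aE eqxx.
    by rewrite inE => /andP[xu /eqP uE] [-> ->]; rewrite uE !eqxx.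
  have -> : (y, inr b) \in SA = false by apply/imsetP => -[].
  by rewrite orbF; apply/eqP/imsetP => [->|[b' _ [->]]//]; exists b.
rewrite cardsU disjoint_setI0 ?cards0 ?subn0 ?card_imset ?card_ord //.
- by move=> u u' [].
- by move=> b b' [].
- rewrite -setI_eq0; apply/eqP/setP => r; rewrite !inE.
  by apply/negP => /andP[/imsetP[b _ ->] /imsetP[]].
Qed.

Lemma max_deg_meredith : 0 < #|G| -> 0 < n -> max_deg M = n.+1.
Proof.
move=> /card_gt0P[x _] n0; apply/eqP; rewrite eqn_leq; apply/andP; split.
  apply/bigmax_leqP => -[y [a|b]] _; last by rewrite deg_meredith_inr.
  rewrite deg_meredith_inl; apply: (@leq_trans (n + 1)); last by rewrite addn1.
  rewrite leq_add2l; apply/card_le1_eqP => u u'.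
  rewrite !inE => /andP[yu /eqP <-] /andP[yu' /eqP E].
  by apply: (port_inj Gn) E; rewrite inE.
by rewrite -(deg_meredith_inr x (Ordinal n0)) deg_le_max.
Qed.

Lemma min_deg_meredith : 0 < #|G| -> n <= min_deg M.
Proof.
move=> G0; rewrite /min_deg; elim/big_rec: _ => [|[y [a|b]] m _ nm].
(* The default value of the minimum, the number of vertices, has to be at least n too. *)
- rewrite card_prod card_sum !card_ord (leq_trans (leq_addl n.+1 n)) //.
  by rewrite leq_pmull.
- by rewrite leq_min nm deg_meredith_inl leq_addr.
- by rewrite leq_min nm deg_meredith_inr leqnSn.
Qed.

(** With k = n+1 these free ports are where the distinguished paths have to start. *)
Lemma meredith_deg_classP (r : M) :
  reflect (exists2 a, r.2 = inl a & forall u, adj r.1 u -> port n r.1 u != a)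
    (r \in deg_class M n).
Proof.
rewrite inE; case: r => x [a|b] /=.
  rewrite deg_meredith_inl -[X in _ == X]addn0 eqn_add2l cards_eq0.
  apply: (iffP eqP) => [/setP U|[_ [<-] free]].
    by exists a => // u xu; have := U u; rewrite !inE xu => /negbT.
  by apply/setP => u; rewrite !inE; apply/negP => /andP[/free/negP].
by rewrite deg_meredith_inr gtn_eqF //; constructor=> -[].
Qed.

Lemma free_port_lt (x : G) (a : 'I_n.+1) :
  (forall u, adj x u -> port n x u != a) -> deg x <= n.
Proof.
move=> free; rewrite /deg -(card_in_imset (@port_inj G n x Gn)).
apply: (@leq_trans #|~: [set a]|); last by rewrite cardsC1 card_ord.
apply: subset_leq_card; apply/subsetP=> _ /imsetP[w wN ->].
by rewrite !inE in wN *; apply: free.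
Qed.

(** Two free ports and at least n occupied ones would exceed n+1. So a copy contains at most one
    vertex of degree n once the degrees in [G] are at least n. *)
Lemma free_port_uniq (x : G) (a a' : 'I_n.+1) : n <= deg x ->
  (forall u, adj x u -> port n x u != a) ->
  (forall u, adj x u -> port n x u != a') -> a = a'.
Proof.
move=> nx free free'; apply/eqP/negPn/negP => aa'.
pose P := [set port n x w | w in [set w | adj x w]].
have notP z : (forall u, adj x u -> port n x u != z) -> z \notin P.
  move=> zP; apply/imsetP => -[w wN E]; have := zP w.
  by rewrite -E eqxx inE in wN * => /(_ wN).
have : #|a |: (a' |: P)| <= n.+1 by rewrite -[X in _ <= X]card_ord max_card.
rewrite !cardsU1 in_setU1 negb_or aa' !notP // (card_in_imset (@port_inj G n x Gn)).
by rewrite !add1n ltnS ltnNge nx.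
Qed.

(** Inside a copy everything is joined to the small-side vertex [b0], and a path of [G] is followed
    from copy to copy through the ports. *)
Lemma meredith_connected : 0 < n -> graph_connected G -> graph_connected M.
Proof.
move=> n0 /forallP Gc; pose b0 : 'I_n := Ordinal n0.
have Ms : connect_sym (@adj M) by apply: sym_connect_sym; apply: adj_sym.
have toB (r : M) : connect adj r (B r.1 b0).
  case: r => x [a|b]; first by rewrite connect1 ?adj_inner.
  apply: (@connect_trans _ _ (A x ord0)); last by rewrite connect1 ?adj_inner.
  by rewrite connect1 // adj_sym adj_inner.
have BB x y : connect adj x y -> connect (@adj M) (B x b0) (B y b0).
  case/connectP=> s + ->; elim: s x => [|z s IH] x //= /andP[xz /IH].
  apply: connect_trans; have /connect1 := adj_ports n xz => E.
  apply: connect_trans (toB (A z (port n z x))).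
  by apply: connect_trans E; rewrite Ms; apply: (toB (A x (port n x z))).
apply/forallP => p; apply/forallP => q.
apply: connect_trans (toB p) _; rewrite Ms; apply: connect_trans (toB q) _.
by apply: BB; have /forallP := Gc q.1.
Qed.

Lemma card_meredith : #|M| = #|G| * (n.+1 + n).
Proof. by rewrite card_prod card_sum !card_ord. Qed.

End MeredithDegrees.

(** * Criticality and independence number of the extension *)

Lemma connected_nbr (G : sgraph) : graph_connected G -> 0 < max_deg G ->
  forall v : G, exists u, adj v u.
Proof.
move=> /forallP Gc G0 v.
have [x x0] : exists x : G, 0 < deg x.
  apply/existsP; apply: contraTT G0; rewrite negb_exists -leqNgt => /forallP x0.
  by apply/bigmax_leqP => x _; rewrite leqNgt x0.
have /forallP/(_ x)/connectP[[|u s]] := Gc v; last by case/andP=> vu _ _; exists u.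
by move=> _ vx; subst x; have /card_gt0P[u] := x0; rewrite inE => vu; exists u.
Qed.

Lemma max_deg_gt0_card (G : sgraph) : 0 < max_deg G -> 0 < #|G|.
Proof.
rewrite !lt0n; apply: contra => /eqP/card0_eq G0; rewrite -leqn0.
by apply/bigmax_leqP => x _; have := G0 x; rewrite inE.
Qed.

Lemma critical_meredith (G : sgraph) (n : nat) : 0 < n ->
  critical n.+1 G -> critical n.+1 (meredith G n).
Proof.
move=> n0 [Gc Gmax Gchi Gdel].
have Gn : max_deg G <= n.+1 by rewrite Gmax.
have nbr := @connected_nbr G Gc; rewrite Gmax in nbr; have {}nbr := nbr isT.
have G0 : 0 < #|G| by apply: max_deg_gt0_card; rewrite Gmax.
have nM : n.+1 < chromatic_index (meredith G n).
  rewrite ltnNge; apply/negP => /chromatic_index_leP[c] /(coloring_of_meredith Gn).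
  by move/chromatic_index_leP; rewrite Gchi ltnn.
have Mdel e : e \in edges (meredith G n) ->
    exists c : meredith G n -> meredith G n -> 'I_n.+1, proper_coloring (del_adj e) c.
  apply: meredith_del_colorable => //; first by rewrite Gchi.
  move=> u v uv; apply/(@chromatic_index_leP (del_edge [set u; v])).
  by rewrite Gdel //; apply/edgesP; exists (u, v).
split.
- exact: meredith_connected.
- exact: max_deg_meredith.
(* For the upper bound, some edge is removed, the rest is colored with n+1 colors, and the edge gets
   a new one. *)
- apply/eqP; rewrite eqn_leq nM andbT; apply/chromatic_index_leP.
  have /card_gt0P[x _] := G0.
  have [|c cP] :=
    Mdel [set ((x, inl ord0) : meredith G n); ((x, inr (Ordinal n0)) : meredith G n)].
    by apply/edgesP; eexists (_, _); first exact: (adj_inner x ord0 (Ordinal n0)).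
  exact: proper_coloring_undelete cP.
- move=> e eM; apply/eqP; rewrite eqn_leq; apply/andP; split.
    exact/(@chromatic_index_leP (del_edge e))/Mdel.
  (* If n colors sufficed without [e], then n+1 would suffice for the extension. Writing n as a
     successor provides the nonempty palette of [chromatic_index_leP]. *)
  rewrite leqNgt; apply/negP; case: n n0 {Gmax Gchi Gdel Gn} nM {Mdel} e eM => // n _ nM e eM.
  rewrite ltnS => /(@chromatic_index_leP (del_edge e))[c cP].
  have := @proper_coloring_undelete (meredith G n.+1) e _ c cP.
  by move/chromatic_index_leP; rewrite leqNgt nM.
Qed.

(** For a maximum independent set [S], the large sides over [S] and the small sides elsewhere are
    independent together, and (n+1)|S| + n(|G| - |S|) = n|G| + |S|. *)
Lemma indep_num_meredith (G : sgraph) (n : nat) :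
  n * #|G| + indep_num G <= indep_num (meredith G n).
Proof.
have [S Si ->] : exists2 S : {set G}, independent S & indep_num G = #|S|.
  have [|S Si SE] := @eq_bigmax_cond _ [pred S : {set G} | independent S] (fun S => #|S|).
    apply/card_gt0P; exists set0; apply/forallP => x.
    by rewrite inE.
  by exists S.
pose SB := [set ((p.1, inr p.2) : meredith G n) | p in setX (~: S) [set: 'I_n]].
pose SA := [set ((p.1, inl p.2) : meredith G n) | p in setX S [set: 'I_n.+1]].
have inSA x s : ((x, s) \in SA) = if s is inl _ then x \in S else false.
  apply/imsetP/idP => [[[y a]]|]; first by rewrite !inE => /andP[yS _] [-> ->].
  by case: s => // a xS; exists (x, a); rewrite // !inE xS.
have inSB x s : ((x, s) \in SB) = if s is inr _ then x \notin S else false.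
  apply/imsetP/idP => [[[y a]]|]; first by rewrite !inE => /andP[yS _] [-> ->].
  by case: s => // a xS; exists (x, a); rewrite // !inE xS.
have Ii : @independent (meredith G n) (SA :|: SB).
  have /forallP Sadj := Si.
  apply/forallP => -[x s]; apply/implyP => xs; apply/forallP => -[y s']; apply/implyP.
  move: xs; rewrite !inE !inSA !inSB /= /meredith_adj /=.
  case: s s' => [a|b] [a'|b']; rewrite ?orbF //=.
  - move=> xS yS; apply/negP => /and3P[xy _ _].
    by have /implyP/(_ xS)/forallP/(_ y)/implyP/(_ yS)/negP := Sadj x.
  - by move=> xS yS; apply: contraNneq yS => <-.
  - by move=> xS yS; apply: contraNneq xS => ->.
apply: leq_trans (leq_bigmax_cond (F := fun S : {set meredith G n} => #|S|) _ Ii).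
rewrite cardsU disjoint_setI0 ?cards0 ?subn0; last first.
  rewrite -setI_eq0; apply/eqP/setP => -[x [a|b]]; rewrite !inE !inSA !inSB ?andbF //.
rewrite !card_imset; [|by move=> [x a] [y b] [-> ->]..].
rewrite !cardsX !cardsT !card_ord -(cardsC S) mulnDr mulnSr [n * _]mulnC.
by rewrite addnAC [n * _]mulnC addnAC.
Qed.

(** * Lifting distinguished paths *)

Section LongPaths.
Variable n : nat.

(** The conditions of [distinguished_paths] with a free bound [m] on the number of vertices, which
    serves as induction variable. *)
Definition long_paths (m : nat) (G : sgraph) (p : G -> 'I_n -> seq G) : Prop :=
  let V v i := path_verts v (p v i) in
  forall v : G, v \in deg_class G n -> forall i j : 'I_n,
  [/\ graph_path v (p v i),
      V v i :&: deg_class G n = [set v],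
      m <= #|V v i|,
      (i != j -> V v i :&: V v j = [set v])
    & forall w : G, w \in deg_class G n -> w != v ->
      V v i :&: V w j = set0].

Lemma long_paths1 (G : sgraph) : @long_paths 1 G (fun _ _ => [::]).
Proof.
have E v : path_verts v [::] = [set v] :> {set G} by apply/setP => x; rewrite !inE.
move=> v vn i j; rewrite !E cards1 setIid; split=> //; last first.
  move=> w _ wv; rewrite E; apply/setP => x; rewrite !inE; apply: contraNF wv.
  by case/andP=> /eqP<- /eqP<-.
by apply/setIidPl; rewrite sub1set.
Qed.

Variable G : sgraph.
Hypothesis Gn : max_deg G <= n.+1.
Hypothesis nG : n <= min_deg G.

Local Notation M := (meredith G n).
Local Notation A x a := ((x, inl a) : M).
Local Notation B x b := ((x, inr b) : M).

(** Each copy is crossed from entry port to exit port through the small-side vertex [i]. The vertex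
    [x] only names the first entry port; how the copy of [x] is left is up to the caller. *)
Fixpoint lift_path (i : 'I_n) (x y : G) (s : seq G) : seq M :=
  A y (port n y x) ::
  if s is z :: s' then B y i :: A y (port n y z) :: lift_path i y z s' else [::].

(** Through this projection the lifted paths inherit disjointness from [G]. *)
Lemma lift_path_fst i x y s r : r \in lift_path i x y s -> r.1 \in y :: s.
Proof.
elim: s x y => [|z s IH] x y /=; first by rewrite !inE => /eqP->; rewrite eqxx.
rewrite inE => /predU1P[->|]; first by rewrite mem_head.
rewrite inE => /predU1P[->|]; first by rewrite mem_head.
rewrite inE => /predU1P[->|/IH]; first by rewrite mem_head.
by move=> rs; rewrite inE rs orbT.
Qed.

Lemma lift_path_path i x y s : path adj x (y :: s) ->
  path adj (A x (port n x y)) (lift_path i x y s).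
Proof.
elim: s x y => [|z s IH] x y /= /andP[xy yz].
  by rewrite andbT; apply: adj_ports.
have Ai a : adj (B y i) (A y a) by rewrite adj_sym adj_inner.
apply/and4P; split; [exact: adj_ports | exact: adj_inner | exact: Ai | exact: IH].
Qed.

Lemma lift_path_uniq i x y s : path adj x (y :: s) -> uniq (x :: y :: s) ->
  uniq (lift_path i x y s).
Proof.
elim: s x y => [|z s IH] x y //=; case/andP=> xy yzs /andP[xn yn].
have yN t : (y, t) \notin lift_path i y z s.
  apply/negP => /lift_path_fst /=; apply/negP; by case/andP: yn.
rewrite !yN IH //= !inE !negb_or !yN !andbT -andbA.
apply/and3P; split; [by apply/eqP | | by apply/eqP].
(* Entry and exit port at [y] differ because the path does not return to [x]. *)
apply/eqP => -[/(port_inj Gn)]; rewrite !inE adj_sym xy; case/andP: yzs => -> _.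
by move/(_ isT isT) => xz; rewrite xz !inE eqxx orbT in xn.
Qed.

Lemma size_lift_path i x y s : size (y :: s) <= size (lift_path i x y s).
Proof.
elim: s x y => // z s IH x y; rewrite ltnS.
exact: leq_trans (IH y z) (leqW (leqW _)).
Qed.

Lemma card_path_verts (H : sgraph) (x : H) s : graph_path x s ->
  #|path_verts x s| = (size s).+1.
Proof. by case/andP=> _ /card_uniqP us; rewrite /path_verts cardsE us. Qed.

(* The i-th path is to leave the copy of K_(n+1,n) at v through (v, inl (e v i)). *)
Definition exits_for (p : G -> 'I_n -> seq G) (e : G -> 'I_n -> 'I_n.+1) : Prop :=
  forall v, v \in deg_class G n ->
  [/\ injective (e v),
      forall a i, (forall u, adj v u -> port n v u != a) -> e v i != a
    & forall i y s, p v i = y :: s -> e v i = port n v y].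

(** If [m] is at least 2, every path has a first edge, which dictates its exit; exits differ because
    the paths share only [v]. Otherwise one-vertex paths are enough, and the n ports other than the
    free one serve as exits. *)
Lemma exits_exist m : (exists p, @long_paths m G p) ->
  exists p e, long_paths m p /\ exits_for p e.
Proof.
move=> [p pP]; case: (leqP m 1) => [m1|m2].
  exists (fun _ _ => [::]).
  (* If no port is free, [fr] takes its default and the condition on free ports is vacuous. *)
  pose fr (v : G) := odflt ord0 [pick a | [forall u, adj v u ==> (port n v u != a)]].
  exists (fun v => lift (fr v)); split.
    move=> v vn i j; have [E1 E2 E3 E4 E5] := @long_paths1 G v vn i j.
    by split=> //; apply: leq_trans m1 E3.
  move=> v vn; split=> // [i j|a i afree]; first exact: lift_inj.
  suff <- : fr v = a by rewrite eq_sym neq_lift.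
  rewrite /fr; case: pickP => [a' /forallP a'free|/(_ a)/negP []] /=; last first.
    by apply/forallP => u; apply/implyP/afree.
  apply: (free_port_uniq Gn _ _ afree); first exact: leq_trans nG (min_deg_le v).
  by move=> u vu; have := a'free u; rewrite vu.
have pE v i : v \in deg_class G n -> exists y s, p v i = y :: s.
  move=> vn; have [gp _ mp _ _] := pP v vn i i; rewrite card_path_verts // in mp.
  case: (p v i) mp => [|y s] /=; last by exists y, s.
  by move=> mp; have := leq_trans m2 mp.
have padj v i y s : v \in deg_class G n -> p v i = y :: s -> adj v y.
  by move=> vn E; have [/andP[]] := pP v vn i i; rewrite E /= => /andP[].
exists p, (fun v i => port n v (head v (p v i))); split=> // v vn; split.
- move=> i j; have [y [s iE]] := pE v i vn; have [y' [s' jE]] := pE v j vn.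
  rewrite iE jE /= => /(port_inj Gn) yE; apply/eqP/negPn/negP => ij.
  have {}yE : y = y' by apply: yE; rewrite inE; apply: padj; eauto.
  have [/andP[_ us] _ _ /(_ ij)/setP/(_ y)] := pP v vn i j.
  rewrite !inE iE jE -yE !inE eqxx orbT; rewrite iE /= inE in us.
  by case: eqVneq us => // ->; rewrite eqxx.
- move=> a i afree; have [y [s iE]] := pE v i vn.
  by rewrite iE; apply: afree; apply: padj iE.
- by move=> i y s ->.
Qed.

(** From the free port over [x] the [i]-th path passes the small-side vertex [i], leaves through its
    own exit and then follows the lift of [p x i]. Different [i] give different vertices in the copy
    of [x]; elsewhere disjointness comes from [G]. *)
Lemma long_paths_meredith m : (exists p, @long_paths m G p) ->
  exists p, @long_paths m.+1 M p.
Proof.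
move=> /exits_exist[p [e [pP eP]]].
pose rest x i := if p x i is y :: s then lift_path i x y s else [::].
pose P (r : M) i := B r.1 i :: A r.1 (e r.1 i) :: rest r.1 i.
have rest_fst x i r : r \in rest x i -> r.1 \in p x i.
  by rewrite /rest; case: (p x i) => // y s; apply: lift_path_fst.
have P_fst q i r : r \in q :: P q i -> r.1 \in q.1 :: p q.1 i.
  rewrite !inE => /or4P[/eqP->|/eqP->|/eqP->|/rest_fst->]; rewrite ?eqxx ?orbT //.
have classG x a : (forall u, adj x u -> port n x u != a) -> x \in deg_class G n.
  move=> afree; rewrite inE eqn_leq (free_port_lt Gn afree).
  exact: leq_trans nG (min_deg_le x).
exists P => V q qM i j; rewrite {}/V.
have [a qa afree] := meredith_deg_classP _ qM.
case: q qM qa afree => x s /= qM sa; subst s => afree.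
have xG := classG _ _ afree.
have uniq_free r : r \in deg_class M n -> r.1 = x -> r = A x a.
  case: r => y s rM /= yx; subst y; congr (_, _).
  have [a' /= -> a'free] := meredith_deg_classP _ rM; congr inl.
  by apply: (free_port_uniq Gn _ a'free afree); apply: leq_trans nG (min_deg_le x).
have inG r : r \in deg_class M n -> r.1 \in deg_class G n.
  by case/meredith_deg_classP => a' _; apply: classG.
have [einj efree eport] := eP x xG.
have gP k : graph_path (A x a) (P (A x a) k).
  have [/andP[pk uk] _ _ _ _] := pP x xG k k.
  have xp : x \notin p x k by case/andP: uk.
  have xrest b : (x, b) \notin rest x k.
    by apply: contra xp => /rest_fst.
  rewrite /graph_path /P; apply/andP; split.
    have Ai a' : adj (B x k) (A x a') by rewrite adj_sym adj_inner.
    apply/and3P; split; [exact: adj_inner | exact: Ai |].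
    rewrite /rest; case E: (p x k) pk => [|y s] // pk.
    by rewrite (eport _ _ _ E); apply: lift_path_path.
  rewrite !cons_uniq !inE !negb_or !xrest !andbT /=.
  apply/and3P; split.
  - apply/andP; split; first by apply/eqP.
    by apply: contra_neq (efree a k afree) => -[].
  - by apply/eqP.
  - rewrite /rest; case E: (p x k) pk uk => [|y s] // pk uk.
    exact: lift_path_uniq.
split=> //.
- apply/setP => r; rewrite !inE; apply/andP/eqP => [[rP rM]|->]; last first.
    by rewrite eqxx; split=> //; have := qM; rewrite inE.
  apply: uniq_free; first by rewrite inE.
  have := P_fst (A x a) i r; rewrite !inE => /(_ rP) rp.
  have [_ /setP/(_ r.1) + _ _ _] := pP x xG i i; rewrite !inE rp.
  by have := inG r; rewrite !inE => /(_ rM) -> /esym/eqP.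
- have [gx _ mx _ _] := pP x xG i i; rewrite card_path_verts // in mx.
  rewrite (card_path_verts (gP i)) ltnS; apply: leq_trans mx _; rewrite /= ltnS.
  rewrite /rest; case: (p x i) => // y s'; apply: leq_trans (size_lift_path i x y s') _.
  exact: leqnSn.
- move=> ij; apply/setP => r; rewrite in_setI !in_set in_set1.
  apply/andP/eqP => [[ri rj]|->]; last by rewrite !inE eqxx.
  (* A common vertex projects to a common vertex of two paths from [x], hence to [x] itself. *)
  have rx : r.1 = x.
    have [_ _ _ /(_ ij)/setP/(_ r.1) + _] := pP x xG i j.
    by rewrite !inE; have := P_fst _ _ _ ri; have := P_fst _ _ _ rj;
      rewrite !inE => -> -> /esym/eqP.
  have xrest k : r \notin rest x k.
    have [/andP[_ /andP[xp _]] _ _ _ _] := pP x xG k k.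
    by apply: contra xp => /rest_fst; rewrite rx.
  move: ri rj; rewrite !inE /= (negPf (xrest i)) (negPf (xrest j)) !orbF.
  case/or3P => /eqP-> // /or3P[] /eqP // [].
  + by move=> E; rewrite E eqxx in ij.
  + by move=> /einj E; rewrite E eqxx in ij.
- move=> w wM wq; have xw : w.1 != x by apply: contra_neq wq; apply: uniq_free.
  have [_ _ _ _ /(_ w.1 (inG w wM) xw)/setP E] := pP x xG i j.
  apply/setP => r; rewrite in_setI !in_set.
  apply/negP => /andP[ri rj].
  have := E r.1; rewrite !inE.
  by have := P_fst _ _ _ ri; have := P_fst _ _ _ rj; rewrite !inE => -> ->.
Qed.

End LongPaths.

(** * Iterated extension and the suprema *)

(** Since |M| = 2n|G| + |G|, cancelling 2n|G| in [indep_num_meredith] leaves the bound for [G]. *)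
Lemma half_indep_meredith (G : sgraph) (n : nat) :
  2 * indep_num (meredith G n) <= #|meredith G n| -> 2 * indep_num G <= #|G|.
Proof.
move=> H; have := indep_num_meredith G n; rewrite -(leq_pmul2l (isT : 0 < 2)).
move/leq_trans/(_ H); rewrite card_meredith mulnDr addSn mulnS addnn -muln2.
by rewrite [#|G| * _]mulnC [n * 2]mulnC -mulnA addnC leq_add2r.
Qed.

Lemma critical_long_paths (G : sgraph) (n m : nat) : 0 < n -> critical n.+1 G ->
  exists H, [/\ critical n.+1 H, n <= min_deg H,
    exists p, @long_paths n m H p & 2 * indep_num H <= #|H| -> 2 * indep_num G <= #|G|].
Proof.
move=> n0 Gcrit; elim: m => [|m [H [Hcrit nH Hp Hind]]].
  have [_ Gmax _ _] := Gcrit; have Gn : max_deg G <= n.+1 by rewrite Gmax.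
  (* One extension is made already for [m] = 0, since [G] may have vertices of degree below n. *)
  exists (meredith G n); split.
  - exact: critical_meredith.
  - by apply: min_deg_meredith; apply: max_deg_gt0_card; rewrite Gmax.
  - exists (fun _ _ => [::]) => V v vn i j.
    by have [E1 E2 _ E4 E5] := @long_paths1 n (meredith G n) v vn i j.
  - exact: half_indep_meredith.
have [_ Hmax _ _] := Hcrit; have Hn : max_deg H <= n.+1 by rewrite Hmax.
exists (meredith H n); split.
- exact: critical_meredith.
- by apply: min_deg_meredith; apply: max_deg_gt0_card; rewrite Hmax.
- exact: long_paths_meredith.
- by move/half_indep_meredith.
Qed.

Lemma indep_num_le (G : sgraph) : indep_num G <= #|G|.
Proof. by apply/bigmax_leqP => S _; apply: max_card. Qed.

Import Order.TTheory GRing.Theory Num.Theory.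
Local Open Scope ring_scope.

Lemma indep_ratio_le_half (R : realType) (G : sgraph) :
  (indep_ratio R G <= 1 / 2) = (2 * indep_num G <= #|G|)%N.
Proof.
have := indep_num_le G; rewrite /indep_ratio; case: (posnP #|G|) => [->|G0].
  (* Without vertices the ratio is 0 by the convention on division by zero. *)
  by rewrite leqn0 => /eqP->; rewrite muln0 invr0 mulr0 divr_ge0.
by rewrite ler_pdivrMr ?ltr0n // mul1r mulrC ler_pdivlMr ?ltr0n // -natrM ler_nat mulnC.
Qed.

Lemma indep_ratio_le1 (R : realType) (G : sgraph) : indep_ratio R G <= 1.
Proof.
have := indep_num_le G; rewrite /indep_ratio; case: (posnP #|G|) => [->|G0] le.
  by rewrite invr0 mulr0.
by rewrite ler_pdivrMr ?ltr0n // mul1r ler_nat.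
Qed.

Local Open Scope classical_set_scope.

(** Turns both suprema into statements about single graphs: ratios are bounded by 1, and the empty
    set has supremum 0. *)
Lemma sup_indep_ratio_le (R : realType) (P : sgraph -> Prop) :
  sup [set x : R | exists2 G, P G & x = indep_ratio R G] <= 1 / 2 <->
  (forall G, P G -> (2 * indep_num G <= #|G|)%N).
Proof.
set E := [set x | _]; split=> [supE G PG|H].
  rewrite -(indep_ratio_le_half R); apply: le_trans supE; apply: ub_le_sup.
    by exists 1 => _ [H _ ->]; apply: indep_ratio_le1.
  by exists G.
have [->|/set0P nE] := eqVneq E classical_sets.set0; first by rewrite sup0 divr_ge0.
by apply: ge_sup => // _ [G /H + ->]; rewrite indep_ratio_le_half.
Qed.

Theorem theorem2p9 (R : realType) (k t : nat) (hk : (2 <= k)%N) :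
  sup_ratio R k <= 1 / 2 <-> sup_ratio_paths R k t <= 1 / 2.
Proof.
rewrite /sup_ratio /sup_ratio_paths !sup_indep_ratio_le.
(* One direction is the inclusion of C(k,t) in C(k); for the other, paths of the required length are
   produced by iterated extension. *)
split=> H G; first by case=> /H.
case: k hk H => // n n0 H Gcrit.
have [K [Kcrit nK Kp]] := critical_long_paths (2 * t * n + 2) n0 Gcrit.
by apply; apply: H; split.
Qed.
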